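(* For every number of candidates $m\ge 2$ and every $\beta\ge 1$, the utilitarian distortion of the Copeland rule under the Plackett–Luce model with parameter $\beta$ satisfies $$\mathcal{D}_{m,\beta}(\mathrm{Copeland})\;\le\;\beta\,\frac{1+e^{-\beta}}{1-e^{-\beta}}.$$
   Context: Setting. $C$ is a set of $m$ candidates and $\beta\ge 1$ is a real parameter. Let $\mathcal{V}$ be a probability distribution on $[0,1]^C$ (utility vectors). For each $n$, the utility vectors $\mathbf{u}_1,\dots,\mathbf{u}_n$ of $n$ voters are drawn i.i.d. from $\mathcal{V}$, with $u_{i,j}\in[0,1]$ the utility of voter $i$ for candidate $j$. Given the utilities, each voter $i$ independently submits a random ranking $\pi_i$ of $C$ drawn from the Plackett–Luce model: positions are filled from top to bottom, and at each step a candidate $j$ is chosen among the not yet ranked candidates with probability proportional to $e^{\beta u_{i,j}}$. A voting rule $f$ maps each profile $\pi^n=(\pi_1,\dots,\pi_n)$ (for every $n$) to a probability distribution over $C$; it is deterministic if it always selects a single winner. Put $\mathrm{Util}_j=\mathbb{E}_{\mathbf{u}\sim\mathcal{V}}[u_j]$ and $\mathrm{Util}_n(f)=\mathbb{E}\big[\tfrac1n\sum_{i=1}^n u_{i,f(\pi^n)}\big]$, the expectation being over utilities, rankings and any internal randomness of $f$. The utilitarian distortion is $$\mathcal{D}_{m,\beta}(f)=\sup_{\mathcal{V}}\ \limsup_{n\to\infty}\ \frac{\max_{j\in C}\mathrm{Util}_j}{\mathrm{Util}_n(f)},$$ with the ratio taken to be $1$ if numerator and denominator are both $0$. Copeland rule.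 Fix a strict ordering $\triangleright$ of the candidates for tie-breaking. Let $s_{j,j'}$ be the fraction of voters ranking $j$ above $j'$. The Copeland score of $j$ is $\sum_{j'\ne j}\big[\mathbb{1}(s_{j,j'}>\tfrac12)+\mathbb{1}(s_{j,j'}=\tfrac12\text{ and }j\triangleright j')\big]$. The rule selects a candidate of maximum Copeland score, ties in the score being broken by $\triangleright$. *)

(* Defs.v *)
From HB Require Import structures.
From mathcomp Require Import all_boot all_order all_algebra perm.
From mathcomp Require Import all_classical all_reals all_analysis.

Set Implicit Arguments.
Unset Strict Implicit.
Unset Printing Implicit Defensive.

Import Order.TTheory GRing.Theory Num.Theory.
Import numFieldNormedType.Exports.

Local Open Scope classical_set_scope.
Local Open Scope ring_scope.

(* The candidates are the elements of 'I_m.  A utility vector is an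
   m.-tuple R, which carries the product (Borel) sigma-algebra.  A ranking is
   a permutation r : {perm 'I_m}, where r j is the position of candidate j,
   position 0 being the top; so j is ranked above k iff r j < r k. *)

Section IIDSample.
Context d (T : measurableType d) (R : realType).

Definition consT n (x : T * n.-tuple T) : n.+1.-tuple T :=
  [tuple of x.1 :: x.2].

Lemma measurable_consT n : measurable_fun [set: T * n.-tuple T] (@consT n).
Proof. exact: measurable_cons. Qed.

HB.instance Definition _ n :=
  isMeasurableFun.Build _ _ _ _ (@consT n) (@measurable_consT n).

(* n-fold product of V: the law of n i.i.d. draws from V *)
Fixpoint iid_law (V : probability T R) (n : nat) : probability (n.-tuple T) R :=
  match n return probability (n.-tuple T) R with
  | 0 => dirac [tuple]
  | n'.+1 => distribution (V \x iid_law V n')%E (@consT n')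
  end.

End IIDSample.

Section Distortion.
Context (R : realType) (m : nat).

(* When j is placed, the candidates still unranked are those k (j included)
   with r j <= r k. *)
Definition plackett_luce (beta : R) (u : m.-tuple R) (r : {perm 'I_m}) : R :=
  \prod_(j < m)
    (expR (beta * tnth u j)
       / \sum_(k < m | (r j <= r k)%N) expR (beta * tnth u k)).

Record voting_rule := VotingRule {
  win_prob :> forall n : nat, n.-tuple {perm 'I_m} -> 'I_m -> R;
  win_prob_ge0 : forall n (p : n.-tuple {perm 'I_m}) j, 0 <= win_prob p j;
  win_prob_sum1 : forall n (p : n.-tuple {perm 'I_m}),
    \sum_(j < m) win_prob p j = 1 }.

Definition unit_utilities : set (m.-tuple R) :=
  [set u | forall j, 0 <= tnth u j <= 1].

Definition util_cand (V : probability (m.-tuple R) R) (j : 'I_m) : \bar R :=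
  'E_V[fun u => tnth u j].

Definition max_util (V : probability (m.-tuple R) R) : \bar R :=
  \big[maxe/-oo%E]_(j < m) util_cand V j.

Definition avg_util n (us : n.-tuple (m.-tuple R)) (j : 'I_m) : R :=
  n%:R^-1 * \sum_(i < n) tnth (tnth us i) j.

(* The expected average utility of the winner, given the utilities: the
   rankings are independent Plackett-Luce draws, and the winner is then drawn
   from f. *)
Definition cond_util (beta : R) (f : voting_rule) n
    (us : n.-tuple (m.-tuple R)) : R :=
  \sum_(p : n.-tuple {perm 'I_m})
    (\prod_(i < n) plackett_luce beta (tnth us i) (tnth p i)) *
    \sum_(j < m) f n p j * avg_util us j.

Definition util_rule (beta : R) (V : probability (m.-tuple R) R)
    (f : voting_rule) (n : nat) : \bar R :=
  'E_(iid_law V n)[cond_util beta f (n := n)].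

(* In \bar R, x / 0 is +oo for x > 0. *)
Definition util_ratio (x y : \bar R) : \bar R :=
  (if (x == 0) && (y == 0) then 1 else x / y)%E.

Definition distortion (beta : R) (f : voting_rule) : \bar R :=
  ereal_sup
    [set limn_esup (fun n => util_ratio (max_util V) (util_rule beta V f n)) |
      V in [set V : probability (m.-tuple R) R | V unit_utilities = 1%E]].

Section Deterministic.
Variable w : forall n : nat, n.-tuple {perm 'I_m} -> 'I_m.

Let dw n (p : n.-tuple {perm 'I_m}) (j : 'I_m) : R := (j == w p)%:R.

Let dw_ge0 n (p : n.-tuple {perm 'I_m}) j : 0 <= dw p j.
Proof. exact: ler0n. Qed.

Let dw_sum1 n (p : n.-tuple {perm 'I_m}) : \sum_(j < m) dw p j = 1.
Proof.
rewrite (bigD1 (w p)) //= /dw eqxx big1 ?addr0 // => j /negPf -> //.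
Qed.

Definition deterministic_rule : voting_rule := VotingRule dw_ge0 dw_sum1.

End Deterministic.

Definition strict_total_order (tri : rel 'I_m) : Prop :=
  [/\ irreflexive tri, transitive tri &
      forall j k, j != k -> tri j k || tri k j].

Definition pref_frac n (p : n.-tuple {perm 'I_m}) (j k : 'I_m) : R :=
  #|[pred i : 'I_n | (tnth p i j < tnth p i k)%N]|%:R / n%:R.

Definition copeland_score (tri : rel 'I_m) n (p : n.-tuple {perm 'I_m})
    (j : 'I_m) : nat :=
  (\sum_(k < m | k != j)
     ((2^-1 < pref_frac p j k)%R + ((pref_frac p j k == 2^-1) && tri j k)%R))%N.

Definition copeland_beats (tri : rel 'I_m) n (p : n.-tuple {perm 'I_m})
    (j k : 'I_m) : bool :=
  (copeland_score tri p k < copeland_score tri p j)%N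
  || (copeland_score tri p j == copeland_score tri p k) && tri j k.

(* The default Ordinal (ltnW hm) is never used when tri is a strict total
   order, see copeland_winnerP. *)
Definition copeland_winner (hm : (1 < m)%N) (tri : rel 'I_m) n
    (p : n.-tuple {perm 'I_m}) : 'I_m :=
  odflt (Ordinal (ltnW hm))
    [pick j | [forall k, (k != j) ==> copeland_beats tri p j k]].

Lemma copeland_winnerP (hm : (1 < m)%N) (tri : rel 'I_m) n
    (p : n.-tuple {perm 'I_m}) (k : 'I_m) :
  strict_total_order tri -> k != copeland_winner hm tri p ->
  copeland_beats tri p (copeland_winner hm tri p) k.
Proof.
case=> irr tr tot; rewrite /copeland_winner; case: pickP => /= [j Hj|none].
  by move/forallP: Hj => /(_ k) /implyP.
exfalso; pose s := copeland_score tri p.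
have [a _ amax] := @arg_maxnP 'I_m (Ordinal (ltnW hm)) xpredT s isT.
have [b /andP[bs _] bmin] :=
  @arg_minnP 'I_m a (fun j => (s j == s a) && true)
    (fun j => #|[pred k | (s k == s a) && tri k j]|)
    (introT andP (conj (eqxx _) isT)).
have := none b; move/negbT/forallPn => [c]; rewrite negb_imply => /andP[cb].
rewrite /copeland_beats -/(s c) -/(s b) negb_or -leqNgt => /andP[bc nb].
have scb : s c = s b.
  by apply/eqP; rewrite eqn_leq bc (eqP bs) andbT; exact: amax.
move: nb; rewrite scb eqxx /= => nbc.
have tcb : tri c b by case/orP: (tot _ _ cb) => // H; rewrite H in nbc.
have sca : (s c == s a) && true by rewrite scb bs.
have := bmin c sca; rewrite leqNgt => /negP; apply.
apply: proper_card; apply/properP; split.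
  apply/fintype.subsetP => x; rewrite !inE => /andP[-> xc] /=.
  exact: tr xc tcb.
exists c; first by rewrite inE tcb scb bs.
by rewrite inE irr andbF.
Qed.

Definition copeland (hm : (1 < m)%N) (tri : rel 'I_m) : voting_rule :=
  deterministic_rule (copeland_winner hm tri).

End Distortion.

(* Main.v *)
(* Write [h x] for the centered logistic function of [beta * x]; under
   Plackett-Luce a voter ranks [j] above [k] with probability
   [1/2 + h (u_j - u_k)].  On the one hand [h] is [beta/4]-Lipschitz, on the
   other hand it is concave on the positive half-line, so that
   [h c >= h 1 * c] on the unit interval; together these give
     [2 h (a - b) + h (b - c) <= (beta/2) a - h 1 * c]
   for [a], [b], [c] in the unit interval.  The Copeland winner [w] is a king of
   the majority tournament: every [k] is reached from it through some [l] such
   that [w] ties or beats [l] and [l] ties or beats [k].  Averaging the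
   inequality over the voters with [a], [b], [c] the utilities of [w], [l],
   [k], the left-hand side is nonnegative up to the deviation of the pairwise
   vote fractions from their conditional means given the utilities, which is of
   order [1/sqrt n] in expectation.  Taking expectations,
   [h 1 * Util_k <= (beta/2) * Util_n + o(1)], and [(beta/2) / h 1] is the
   claimed bound. *)

Require Import Defs.
From mathcomp Require Import all_boot all_order all_algebra perm.
From mathcomp Require Import all_classical all_reals all_analysis.
From mathcomp Require Import measurable_realfun ring lra.

Set Implicit Arguments.
Unset Strict Implicit.
Unset Printing Implicit Defensive.

Import Order.TTheory GRing.Theory Num.Theory.
Local Open Scope ring_scope.

(** * Pairwise marginals of the Plackett-Luce model *)

(** A ranking amounts to its top candidate [j] together with a ranking [s] of the others;
    injectivity and a count of factorials give the bijection. *)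
Lemma lift_perm_ord0_bij n :
  bijective (fun x : 'I_n.+1 * {perm 'I_n} => lift_perm x.1 ord0 x.2).
Proof.
have cardP k : #|{: {perm 'I_k}}| = k`! by rewrite -card_Sn; exact: eq_card.
apply: inj_card_bij => [[j s] [k t] /= st|]; last first.
  by rewrite card_prod card_ord !cardP factS.
have jk : j = k.
  by apply: (@perm_inj _ (lift_perm j ord0 s)); rewrite {2}st !lift_perm_id.
subst k; congr (_, _); apply/permP => i.
by apply: (@lift_inj _ ord0); rewrite -!(lift_perm_lift j) st.
Qed.

Lemma sum_lift_perm (R : nzSemiRingType) n (F : {perm 'I_n.+1} -> R) :
  \sum_r F r = \sum_(j < n.+1) \sum_s F (lift_perm j ord0 s).
Proof.
rewrite (reindex _ (onW_bij _ (lift_perm_ord0_bij n))).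
by rewrite (pair_bigA _ (fun j s => F (lift_perm j ord0 s))).
Qed.

Section LuceWeight.
Variable R : realFieldType.

(** The weights are arbitrary so that deleting the top candidate gives a model of the same kind,
    with weights [w \o lift j], as induction on [n] demands. *)
Definition luce_weight {n} (w : 'I_n -> R) (r : {perm 'I_n}) : R :=
  \prod_(j < n) (w j / \sum_(k < n | (r j <= r k)%N) w k).

Lemma luce_weight_ge0 n (w : 'I_n -> R) r :
  (forall i, 0 < w i) -> 0 <= luce_weight w r.
Proof.
move=> w0; apply: prodr_ge0 => j _; apply: divr_ge0; first exact: ltW.
by apply: sumr_ge0 => k _; exact: ltW.
Qed.

Lemma luce_weight_lift n (w : 'I_n.+1 -> R) j s :
  luce_weight w (lift_perm j ord0 s) =
  w j / (\sum_k w k) * luce_weight (w \o lift j) s.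
Proof.
rewrite /luce_weight (bigD1_ord j) //= lift_perm_id; congr (_ / _ * _).
apply: eq_bigr => i _; congr (_ / _).
rewrite big_mkcond (bigD1_ord j) //= lift_perm_lift lift_perm_id /= add0r.
rewrite [RHS]big_mkcond; apply: eq_bigr => k _.
by rewrite lift_perm_lift !lift0 ltnS.
Qed.

Lemma sum_gt0 n (w : 'I_n.+1 -> R) : (forall i, 0 < w i) -> 0 < \sum_i w i.
Proof.
by move=> w0; rewrite (bigD1 ord0) //= ltr_pwDl // sumr_ge0 // => *; exact: ltW.
Qed.

Lemma sum_luce_weight n (w : 'I_n -> R) :
  (forall i, 0 < w i) -> \sum_r luce_weight w r = 1.
Proof.
elim: n w => [|n IH] w w0.
  rewrite (big_pred1 (1%g : {perm 'I_0})) => [|r].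
    by rewrite /luce_weight big_ord0.
  by apply/esym/eqP/permP => -[].
rewrite sum_lift_perm; under eq_bigr do under eq_bigr do rewrite luce_weight_lift.
under eq_bigr => j _ do rewrite -mulr_sumr.
rewrite (eq_bigr (fun j => w j / \sum_k w k)) => [|j _]; last first.
  by rewrite IH ?mulr1 // => i; exact: w0.
by rewrite -mulr_suml divff // gt_eqF // sum_gt0.
Qed.

(** Condition on the top candidate: [j] settles the comparison, [k] refutes it, and any other [i]
    passes it on to the remaining candidates, where the induction hypothesis gives the same
    value. *)
Lemma luce_weight_pair n (w : 'I_n -> R) j k :
  (forall i, 0 < w i) -> j != k ->
  \sum_r luce_weight w r * (r j < r k)%N%:R = w j / (w j + w k).
Proof.
elim: n w j k => [|n IH] w j k w0 jk; first by case: (j).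
have W0 := sum_gt0 w0.
rewrite sum_lift_perm (bigD1 j) //= (bigD1 k) 1?eq_sym //=.
rewrite [X in _ + (X + _)]big1 ?add0r => [|s _]; last first.
  by rewrite lift_perm_id ltn0 mulr0.
have -> : \sum_s luce_weight w (lift_perm j ord0 s) *
    (lift_perm j ord0 s j < lift_perm j ord0 s k)%N%:R = w j / \sum_i w i.
  case: (unlift_some jk) => k' -> _.
  under eq_bigr do rewrite lift_perm_id lift_perm_lift lift0 ltn0Sn mulr1
    luce_weight_lift.
  by rewrite -mulr_sumr sum_luce_weight ?mulr1 // => i; exact: w0.
have E i : (i != j) && (i != k) ->
    \sum_s luce_weight w (lift_perm i ord0 s) *
      (lift_perm i ord0 s j < lift_perm i ord0 s k)%N%:R =
    w i / (\sum_l w l) * (w j / (w j + w k)).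
  case/andP => /unlift_some[j' jj' _] /unlift_some[k' kk' _].
  rewrite {1 2}jj' {1 2}kk'.
  under eq_bigr do rewrite !lift_perm_lift !lift0 ltnS luce_weight_lift -mulrA.
  by rewrite -mulr_sumr IH //= -?jj' -?kk' // -(inj_eq (@lift_inj _ i)) -jj' -kk'.
rewrite (eq_bigr _ E) -!mulr_suml.
have -> : \sum_(i < n.+1 | (i != j) && (i != k)) w i = \sum_i w i - w j - w k.
  by rewrite [in RHS](bigD1 j) //= [in RHS](bigD1 k) 1?eq_sym //=; ring.
have := w0 j; have := w0 k; move: (\sum_i w i) (w j) (w k) W0 => W a b W0 b0 a0.
by field; rewrite !gt_eqF // addr_gt0.
Qed.

End LuceWeight.

(** * The logistic function *)

Section Logistic.
Variable R : realType.
Implicit Types x y : R.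

(* The centered logistic function, i.e. [tanh (x / 2) / 2]. *)
Definition clogistic x : R := (1 + expR (- x))^-1 - 2^-1.

Lemma clogistic_denom_gt0 x : 0 < 1 + expR (- x).
Proof. by rewrite addr_gt0 ?expR_gt0. Qed.

Lemma clogistic0 : clogistic 0 = 0.
Proof. by rewrite /clogistic oppr0 expR0 subrr. Qed.

Lemma clogisticN x : clogistic (- x) = - clogistic x.
Proof.
rewrite /clogistic opprK expRN; have := expR_gt0 x.
by move: (expR x) => e e0; field; rewrite !gt_eqF ?addr_gt0.
Qed.

Lemma clogistic_le x y : x <= y -> clogistic x <= clogistic y.
Proof.
move=> xy; rewrite lerD2r lef_pV2 ?posrE ?clogistic_denom_gt0 //.
by rewrite lerD2l ler_expR lerN2.
Qed.

Lemma clogistic_ge0 x : 0 <= x -> 0 <= clogistic x.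
Proof. by move=> x0; rewrite -clogistic0 clogistic_le. Qed.

(** This form shows both facts used below: the slope is at most 1/4, and it decreases as
    [clogistic x ^+ 2] grows. *)
Lemma is_derive_clogistic x :
  is_derive x 1 clogistic (4^-1 - clogistic x ^+ 2).
Proof.
have d0 := clogistic_denom_gt0 x.
have He : is_derive x 1 (cst 1 + (expR \o -%R)) (0 + expR (- x) * (- 1)).
  apply: is_deriveD; apply: is_derive1_comp.
have Hv := @is_deriveV _ (cst 1 + (expR \o -%R)) _ _ _ (lt0r_neq0 d0) He.
have E : - ((1 + expR (- x)) ^+ 2)^-1 * (0 + expR (- x) * (- 1)) - 0 =
    4^-1 - clogistic x ^+ 2.
  rewrite /clogistic; move: (expR (- x)) d0 => e d0; field.
  by rewrite gt_eqF.
exact: (@is_derive_eq _ _ _ _ _ _ _ _ (is_deriveB Hv (is_derive_cst _ _ _)) E).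
Qed.

Lemma clogistic_MVT x y : x < y -> exists c, [/\ x < c, c < y &
  clogistic y - clogistic x = (4^-1 - clogistic c ^+ 2) * (y - x)].
Proof.
move=> xy; have [|c] := MVT xy (fun z _ => is_derive_clogistic z).
  apply: derivable_within_continuous => z _.
  exact: @ex_derive _ _ _ _ _ _ _ (is_derive_clogistic z).
by rewrite in_itv /= => /andP[xc cy] e; exists c.
Qed.

Lemma clogistic_lipschitz x y : 0 <= y -> clogistic (x + y) <= clogistic x + y / 4.
Proof.
rewrite le_eqVlt => /predU1P[<-|y0]; first by rewrite mul0r !addr0.
have [|c [_ _]] := @clogistic_MVT x (x + y); first by rewrite ltrDl.
have -> : x + y - x = y by ring.
have : 0 <= clogistic c ^+ 2 * y by rewrite mulr_ge0 ?sqr_ge0 // ltW.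
lra.
Qed.

(* Concavity on the positive half-line: the derivative [1/4 - clogistic^2]
   decreases there. *)
Lemma clogistic_chord x y :
  0 <= x -> x <= y -> x * clogistic y <= y * clogistic x.
Proof.
rewrite le_eqVlt => /predU1P[<- _|x0]; first by rewrite clogistic0 mul0r mulr0.
rewrite le_eqVlt => /predU1P[<- //|xy].
have [c [c0 cx]] := clogistic_MVT x0; rewrite clogistic0 !subr0 => Ec.
have [d [xd dy]] := clogistic_MVT xy => /eqP; rewrite subr_eq => /eqP ->.
have gcd : clogistic c ^+ 2 <= clogistic d ^+ 2.
  by rewrite lerXn2r ?nnegrE ?clogistic_ge0 ?clogistic_le //; lra.
have : clogistic c ^+ 2 * (x * (y - x)) <= clogistic d ^+ 2 * (x * (y - x)).
  by rewrite ler_wpM2r // mulr_ge0 //; lra.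
rewrite Ec; lra.
Qed.

(** Add the chord bounds of [x] and of [y] against [x + y], then divide by [x + y]. *)
Lemma clogistic_subadd x y : 0 <= x -> 0 <= y ->
  clogistic (x + y) <= clogistic x + clogistic y.
Proof.
move=> x0 y0; have [->|xy0] := eqVneq (x + y) 0.
  by rewrite clogistic0 addr_ge0 ?clogistic_ge0.
have xy : 0 < x + y by rewrite lt_neqAle eq_sym xy0 addr_ge0.
have h1 : x <= x + y by rewrite lerDl.
have h2 : y <= x + y by rewrite lerDr.
have := clogistic_chord x0 h1; have := clogistic_chord y0 h2.
move=> hy hx; rewrite -(ler_pM2l xy); lra.
Qed.

(* The unequal weights matter: for [2, 1] replaced by [1, 1], taking [a = 0],
   [b = 1] and [c] small leaves only a slope [beta * clogistic'(beta)] in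
   [c], which is exponentially small in [beta]. *)
Lemma clogistic_two_step (beta a b c : R) : 0 <= beta ->
  0 <= a <= 1 -> 0 <= b <= 1 -> 0 <= c <= 1 ->
  2 * clogistic (beta * (a - b)) + clogistic (beta * (b - c)) <=
  beta / 2 * a - clogistic beta * c.
Proof.
move=> beta0 /andP[a0 a1] /andP[b0 b1] /andP[c0 c1].
have bb0 : 0 <= beta * b by rewrite mulr_ge0.
have bc0 : 0 <= beta * c by rewrite mulr_ge0.
have chord t : 0 <= t -> t <= 1 -> clogistic beta * t <= clogistic (beta * t).
  move=> t0 t1; have [->|bn] := eqVneq beta 0.
    by rewrite mul0r clogistic0 mul0r.
  have bp : 0 < beta by rewrite lt_neqAle eq_sym bn.
  rewrite -(ler_pM2l bp) mulrCA mulrC -mulrA mulrC.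
  apply: le_trans (clogistic_chord (mulr_ge0 beta0 t0) _); first by lra.
  by rewrite ler_piMr.
have lipa : clogistic (beta * (a - b)) <= - clogistic (beta * b) + beta * a / 4.
  rewrite -clogisticN mulrBr addrC; apply: clogistic_lipschitz.
  by rewrite mulr_ge0.
(* The Lipschitz bound [lipa], taken twice, pays for exactly [beta / 2 * a], so only the case
   [a = 0] remains. *)
suff : clogistic (beta * (b - c)) <= 2 * clogistic (beta * b) - clogistic beta * c.
  lra.
(* If [c <= b], each of the two terms in [c] is at most [clogistic (beta * b)]. Otherwise the left
   side is negated by oddness and subadditivity splits [c] as [b + (c - b)]. *)
have [cb|/ltW bc] := leP c b.
  have : clogistic (beta * (b - c)) <= clogistic (beta * b).
    by apply: clogistic_le; rewrite ler_wpM2l //; lra.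
  have : clogistic beta * c <= clogistic (beta * b).
    by apply: (le_trans (chord _ c0 c1)); apply: clogistic_le; rewrite ler_wpM2l.
  lra.
have cb0 : 0 <= beta * (c - b) by rewrite mulr_ge0 // subr_ge0.
have := clogistic_subadd bb0 cb0; have := chord _ c0 c1.
have := clogistic_ge0 bb0.
have -> : beta * b + beta * (c - b) = beta * c by ring.
rewrite -[b - c]opprB mulrN clogisticN; lra.
Qed.

End Logistic.

(** * Second moments under product distributions *)

Section TupleProduct.
Variables (R : comNzRingType) (T : finType) (n : nat).
Implicit Types F : 'I_n -> T -> R.

Lemma sum_tuple_prod F :
  \sum_(p : n.-tuple T) \prod_(i < n) F i (tnth p i) =
  \prod_(i < n) \sum_t F i t.
Proof.
rewrite bigA_distr_bigA /=.
pose h (f : {ffun 'I_n -> T}) := [tuple f i | i < n].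
pose g (p : n.-tuple T) := [ffun i => tnth p i].
rewrite (reindex h) /=; last first.
  exists g => [f _|p _]; first by apply/ffunP => i; rewrite ffunE tnth_mktuple.
  by apply: eq_from_tnth => i; rewrite tnth_mktuple ffunE.
by apply: eq_bigr => f _; apply: eq_bigr => i _; rewrite tnth_mktuple.
Qed.

Variable q : 'I_n -> T -> R.
Hypothesis q1 : forall i, \sum_t q i t = 1.

Lemma sum_tuple_prod_cov (Y : 'I_n -> T -> R) a b :
  (forall i, \sum_t q i t * Y i t = 0) ->
  \sum_(p : n.-tuple T) (\prod_(i < n) q i (tnth p i)) *
    (Y a (tnth p a) * Y b (tnth p b)) =
  (a == b)%:R * \sum_t q a t * Y a t ^+ 2.
Proof.
move=> Y0.
(* The two factors are absorbed into the product over coordinates; for [a = b] they meet at one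
   index and form the square. *)
pose F i t := q i t * (if i == a then Y a t else 1) * (if i == b then Y b t else 1).
transitivity (\sum_(p : n.-tuple T) \prod_(i < n) F i (tnth p i)).
  apply: eq_bigr => p _; rewrite !big_split /= -mulrA; congr (_ * (_ * _)).
    by rewrite -big_mkcond big_pred1_eq.
  by rewrite -big_mkcond big_pred1_eq.
have Fa : \prod_(i < n | i != a) \sum_t F i t = (a == b)%:R.
  have [ab|ab] := eqVneq a b.
    apply: big1 => i /negPf ia; rewrite -(q1 i); apply: eq_bigr => t _.
    by rewrite /F -ab ia !mulr1.
  rewrite (bigD1 b) 1?eq_sym //= [X in X * _](_ : _ = 0) ?mul0r //.
  rewrite -[RHS](Y0 b); apply: eq_bigr => t _.
  by rewrite /F eqxx eq_sym (negPf ab) mulr1.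
rewrite sum_tuple_prod (bigD1 a) //= Fa mulrC.
have [ab|ab] := eqVneq a b; last by rewrite !mul0r.
rewrite !mul1r; apply: eq_bigr => t _.
by rewrite /F -ab eqxx expr2 mulrA.
Qed.

(** Expand the square: by independence and centering the cross terms vanish. *)
Lemma sum_tuple_prod_sqr (Y : 'I_n -> T -> R) :
  (forall i, \sum_t q i t * Y i t = 0) ->
  \sum_(p : n.-tuple T) (\prod_(i < n) q i (tnth p i)) *
    (\sum_(i < n) Y i (tnth p i)) ^+ 2 =
  \sum_(i < n) \sum_t q i t * Y i t ^+ 2.
Proof.
move=> Y0.
under eq_bigr => p _ do rewrite expr2 mulr_suml mulr_sumr.
rewrite exchange_big /=; apply: eq_bigr => a _.
under eq_bigr => p _ do rewrite mulr_sumr mulr_sumr.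
rewrite exchange_big /= (bigD1 a) //= [X in _ + X]big1 ?addr0.
  by rewrite (sum_tuple_prod_cov _ _ Y0) eqxx mul1r.
by move=> b /negPf ba; rewrite sum_tuple_prod_cov // eq_sym ba mul0r.
Qed.

End TupleProduct.

(** * Two-step domination by the Copeland winner *)

Section CopelandTournament.
Variables (R : realType) (m : nat) (hm : (1 < m)%N) (tri : rel 'I_m).
Hypothesis htri : strict_total_order tri.
Variable n : nat.
Hypothesis n0 : (0 < n)%N.
Variable p : n.-tuple {perm 'I_m}.

Let nR0 : (n%:R : R) != 0. Proof. by rewrite pnatr_eq0 -lt0n. Qed.

Lemma pref_fracC j k : j != k -> pref_frac R p j k + pref_frac R p k j = 1.
Proof.
move=> jk; rewrite /pref_frac -mulrDl -natrD -[X in (X + _)%N]addn0.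
apply: (mulIf nR0); rewrite mulfVK // mul1r; congr (_%:R).
rewrite addn0 -[RHS](card_ord n).
rewrite -(cardC [pred i : 'I_n | (tnth p i j < tnth p i k)%N]).
congr (_ + _)%N; apply: eq_card => i; rewrite !inE -leqNgt ltn_neqAle.
by rewrite (inj_eq val_inj) (inj_eq perm_inj) eq_sym jk.
Qed.

(** Breaking ties by [tri] makes any two distinct candidates comparable, and turns the Copeland
    score into an out-degree. *)
Let majority j k : bool :=
  (2^-1 < pref_frac R p j k) || (pref_frac R p j k == 2^-1) && tri j k.

Let majority_ge j k : majority j k -> 2^-1 <= pref_frac R p j k.
Proof. by case/orP => [/ltW //|/andP[/eqP -> _]]. Qed.

Let majorityC j k : j != k -> majority j k || majority k j.
Proof.
move=> jk; have [_ _ /(_ _ _ jk) tot] := htri.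
have := pref_fracC jk; rewrite /majority.
move: (pref_frac R p j k) (pref_frac R p k j) => x y xy.
have [x2|x2|x2] := ltgtP 2^-1 x; rewrite ?orbT //=.
  by rewrite (_ : 2^-1 < y = true) ?orbT //; lra.
rewrite (_ : y == 2^-1 = true); last by apply/eqP; lra.
by case/orP: tot => ->; rewrite ?orbT.
Qed.

Let scoreE j : copeland_score R tri p j = #|[pred k | (k != j) && majority j k]|.
Proof.
rewrite /copeland_score -sum1_card big_mkcondr /=; apply: eq_bigr => k _.
rewrite /majority; case: ltgtP => //= _; by case: (tri j k).
Qed.

(* The winner is a king of the majority tournament: were [k] to beat the winner
   and everyone the winner beats, its score would be larger. *)
Lemma copeland_two_step k :
  let w := copeland_winner R hm tri p in
  exists l, (l = w \/ l != w /\ 2^-1 <= pref_frac R p w l) /\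
            (l = k \/ l != k /\ 2^-1 <= pref_frac R p l k).
Proof.
move=> w; have [->|kw] := eqVneq k w; first by exists w; split; left.
have [wk|wk] := boolP (majority w k).
  by exists k; split; [right; rewrite majority_ge|left].
have [/existsP[l /and3P[lw wl lk]]|none] :=
    boolP [exists l, [&& l != w, majority w l & majority l k]].
  exists l; split; right; split; rewrite ?majority_ge //.
  by apply: contraNneq wk => <-.
have kw' : majority k w by have := majorityC kw; rewrite (negPf wk) orbF.
exfalso; have : (copeland_score R tri p w < copeland_score R tri p k)%N.
  rewrite !scoreE; apply: proper_card; apply/properP; split; last first.
    by exists w; rewrite !inE ?eqxx //= eq_sym kw.
  apply/fintype.subsetP => l; rewrite !inE => /andP[lw wl].
  have lk : l != k by apply: contraNneq wk => <-.
  rewrite lk /=; have := majorityC lk => /orP[lk'|//].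
  by case/existsP: none; exists l; rewrite lw wl.
have := @copeland_winnerP R m hm tri n p k htri kw; rewrite -/w /copeland_beats.
by case/orP => [/ltnW|/andP[/eqP -> _]]; rewrite ?ltnn // leqNgt => /negP.
Qed.

End CopelandTournament.

(** * Expected utility given the utilities *)

Section ConditionalUtility.
Variables (R : realType) (m : nat) (hm : (1 < m)%N) (tri : rel 'I_m).
Hypothesis htri : strict_total_order tri.
Variable beta : R.
Hypothesis beta0 : 0 <= beta.

Let w (u : m.-tuple R) (j : 'I_m) : R := expR (beta * tnth u j).

Let plE u r : plackett_luce beta u r = luce_weight (w u) r.
Proof. by []. Qed.

Lemma plackett_luce_ge0 (u : m.-tuple R) r : 0 <= plackett_luce beta u r.
Proof. by rewrite plE luce_weight_ge0 // => j; exact: expR_gt0. Qed.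

Lemma sum_plackett_luce (u : m.-tuple R) : \sum_r plackett_luce beta u r = 1.
Proof. 
by under eq_bigr do rewrite plE; apply: sum_luce_weight => j; exact: expR_gt0. Qed.

Lemma plackett_luce_pair (u : m.-tuple R) j k : j != k ->
  \sum_r plackett_luce beta u r * (r j < r k)%N%:R =
  2^-1 + clogistic (beta * (tnth u j - tnth u k)).
Proof.
move=> jk; under eq_bigr do rewrite plE.
rewrite luce_weight_pair // => [|i]; last exact: expR_gt0.
rewrite /clogistic /w.
have -> : - (beta * (tnth u j - tnth u k)) = beta * tnth u k - beta * tnth u j.
  by ring.
rewrite expRB; have := expR_gt0 (beta * tnth u k).
have := expR_gt0 (beta * tnth u j).
move: (expR (_ * tnth u j)) (expR (_ * tnth u k)) => a b a0 b0; field.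
by rewrite !gt_eqF // addr_gt0.
Qed.

Section Profile.
Variables (n : nat) (us : n.-tuple (m.-tuple R)).
Hypothesis n0 : (0 < n)%N.

Let nR0 : (n%:R : R) != 0. Proof. by rewrite pnatr_eq0 -lt0n. Qed.

Let nRgt0 : 0 < (n%:R : R). Proof. by rewrite ltr0n. Qed.

Let pr (p : n.-tuple {perm 'I_m}) : R :=
  \prod_(i < n) plackett_luce beta (tnth us i) (tnth p i).

Let pr_ge0 p : 0 <= pr p.
Proof. by apply: prodr_ge0 => i _; exact: plackett_luce_ge0. Qed.

Let pr_sum1 : \sum_p pr p = 1.
Proof.
rewrite /pr (sum_tuple_prod (fun i r => plackett_luce beta (tnth us i) r)).
by rewrite big1 // => i _; exact: sum_plackett_luce.
Qed.

(* Expected value of [pref_frac j k - 1/2] given the utilities. *)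
Definition mean_margin (j k : 'I_m) : R := n%:R^-1 *
  \sum_(i < n) clogistic (beta * (tnth (tnth us i) j - tnth (tnth us i) k)).

Definition deviation (p : n.-tuple {perm 'I_m}) (j k : 'I_m) : R :=
  pref_frac R p j k - 2^-1 - mean_margin j k.

(** Contribution of voter [i] to the deviation: an indicator minus its mean, hence centered. *)
Let Y j k i (r : {perm 'I_m}) : R := (r j < r k)%N%:R -
  (2^-1 + clogistic (beta * (tnth (tnth us i) j - tnth (tnth us i) k))).

Let deviationE p j k :
  deviation p j k = n%:R^-1 * \sum_(i < n) Y j k i (tnth p i).
Proof.
rewrite /deviation /mean_margin /pref_frac /Y.
rewrite [in RHS]sumrB [in RHS]big_split /= sumr_const card_ord.
rewrite -sum1_card natr_sum big_mkcond /=.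
rewrite (eq_bigr (fun i : 'I_n => (tnth p i j < tnth p i k)%N%:R : R)); last first.
  by move=> i _; rewrite inE; case: ifP.
by rewrite -[2^-1 *+ n]mulr_natr; field.
Qed.

Let Y_mean0 j k i : j != k ->
  \sum_r plackett_luce beta (tnth us i) r * Y j k i r = 0.
Proof.
move=> jk; under eq_bigr do rewrite mulrBr.
by rewrite sumrB plackett_luce_pair // -mulr_suml sum_plackett_luce mul1r subrr.
Qed.

Let Y_sqr_le1 j k i r : j != k -> Y j k i r ^+ 2 <= 1.
Proof.
(* The mean is turned back into a probability [P], which visibly lies in the unit interval. *)
move=> jk; have := plackett_luce_pair (tnth us i) jk; rewrite /Y => <-.
set P := \sum_s _.
have P0 : 0 <= P by apply: sumr_ge0 => s _; rewrite mulr_ge0 ?plackett_luce_ge0.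
have P1 : P <= 1.
  rewrite -(sum_plackett_luce (tnth us i)); apply: ler_sum => s _.
  by rewrite ler_piMr ?plackett_luce_ge0 // lern1 leq_b1.
by case: (_ < _)%N => /=; nra.
Qed.

(** Variance of an average of [n] independent centered terms, each of variance at most 1. *)
Lemma deviation_sqr j k : j != k ->
  \sum_p pr p * deviation p j k ^+ 2 <= n%:R^-1.
Proof.
move=> jk.
under eq_bigr => p _ do rewrite deviationE exprMn mulrCA.
rewrite -mulr_sumr.
rewrite (sum_tuple_prod_sqr (fun i => sum_plackett_luce (tnth us i))); last first.
  by move=> i; exact: Y_mean0.
rewrite expr2 -mulrA -[leRHS]mulr1 ler_pM2l ?invr_gt0 // -(ler_pM2l nRgt0).
rewrite mulVKf // mulr1 -[leRHS]mul1r.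
have -> : 1 * n%:R = \sum_(i < n) (1 : R) by rewrite sumr_const card_ord mul1r.
apply: ler_sum => i _; rewrite -(sum_plackett_luce (tnth us i)).
apply: ler_sum => r _; rewrite ler_piMr ?plackett_luce_ge0 //.
exact: Y_sqr_le1.
Qed.

(* AM-GM, [|x| <= d / 2 + x ^ 2 / (2 d)], avoids the square root of
   Cauchy-Schwarz. *)
Lemma deviation_norm (d : R) j k : 0 < d -> j != k ->
  \sum_p pr p * `|deviation p j k| <= d / 2 + (2 * d * n%:R)^-1.
Proof.
move=> d0 jk.
have : \sum_p pr p * `|deviation p j k| <=
       \sum_p pr p * (d / 2 + (2 * d)^-1 * deviation p j k ^+ 2).
  apply: ler_sum => p _; apply: ler_wpM2l => //.
  rewrite -(real_normK (num_real (deviation p j k))).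
  set x := `|_|; rewrite -subr_ge0.
  have -> : d / 2 + (2 * d)^-1 * x ^+ 2 - x = (2 * d)^-1 * (d - x) ^+ 2.
    by field; rewrite gt_eqF.
  by rewrite mulr_ge0 ?sqr_ge0 // invr_ge0 mulr_ge0 // ltW.
move/le_trans; apply.
under eq_bigr do rewrite mulrDr [X in _ + X]mulrCA.
rewrite big_split /= -mulr_suml pr_sum1 mul1r lerD2l -mulr_sumr [leRHS]invfM.
rewrite ler_pM2l ?deviation_sqr // invr_gt0 mulr_gt0 //.
Qed.

Hypothesis us01 : forall i j, 0 <= tnth (tnth us i) j <= 1.

Lemma mean_margin_two_step j l k :
  2 * mean_margin j l + mean_margin l k <=
  beta / 2 * avg_util us j - clogistic beta * avg_util us k.
Proof.
rewrite /mean_margin /avg_util !(mulrCA _ n%:R^-1) -mulrDr -mulrBr.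
rewrite ler_pM2l ?invr_gt0 // !mulr_sumr -big_split -sumrB /=.
by apply: ler_sum => i _; exact: clogistic_two_step.
Qed.

Lemma mean_margin_id j : mean_margin j j = 0.
Proof.
by rewrite /mean_margin big1 ?mulr0 // => i _; rewrite subrr mulr0 clogistic0.
Qed.

(** The winner and the intermediate candidate depend on the profile, so the error is bounded by a
    sum over all pairs. *)
Let total_deviation p : R := \sum_j \sum_(k | k != j) `|deviation p j k|.

Let mean_margin_ge p j k : j = k \/ k != j /\ 2^-1 <= pref_frac R p j k ->
  - total_deviation p <= mean_margin j k.
Proof.
have ge0 : forall j, 0 <= \sum_(k | k != j) `|deviation p j k|.
  by move=> i; exact: sumr_ge0.
case=> [->|[kj half]].
  by rewrite mean_margin_id oppr_le0; apply: sumr_ge0.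
have : `|deviation p j k| <= total_deviation p.
  rewrite /total_deviation (bigD1 j) //= (bigD1 k) //= -addrA lerDl.
  by rewrite addr_ge0 ?sumr_ge0.
rewrite ler_norml /deviation; lra.
Qed.

(** The factor 3 adds the weights 2 and 1 of the two steps; [m%:R ^+ 2] bounds the number of ordered
    pairs. *)
Lemma cond_util_copeland (d : R) (k : 'I_m) : 0 < d ->
  clogistic beta * avg_util us k
    - 3 * m%:R ^+ 2 * (d / 2 + (2 * d * n%:R)^-1) <=
  beta / 2 * cond_util beta (copeland R hm tri) us.
Proof.
move=> d0.
have pointwise p : clogistic beta * avg_util us k - 3 * total_deviation p <=
    beta / 2 * \sum_j copeland R hm tri n p j * avg_util us j.
  rewrite (bigD1 (copeland_winner R hm tri p)) //= eqxx mul1r big1 ?addr0; last first.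
    by move=> j /negPf ->; rewrite mul0r.
  have [l [wl lk]] := copeland_two_step R hm htri n0 p k.
  have wl' : - total_deviation p <= mean_margin (copeland_winner R hm tri p) l.
    by apply: mean_margin_ge; case: wl => [->|]; [left|right].
  have lk' : - total_deviation p <= mean_margin l k.
    by apply: mean_margin_ge; case: lk => [->|[? ?]]; [left|right; rewrite eq_sym].
  have := mean_margin_two_step (copeland_winner R hm tri p) l k; lra.
have dev : \sum_p pr p * total_deviation p <=
    m%:R ^+ 2 * (d / 2 + (2 * d * n%:R)^-1).
  set K := d / 2 + _.
  have K0 : 0 <= K by rewrite addr_ge0 ?divr_ge0 ?invr_ge0 ?mulr_ge0 // ltW.
  under eq_bigr do rewrite mulr_sumr.
  rewrite exchange_big /= expr2 -mulrA.
  have cst (x : R) : m%:R * x = \sum_(j < m) x.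
    by rewrite sumr_const card_ord mulr_natl.
  rewrite cst; apply: ler_sum => j _.
  under eq_bigr do rewrite mulr_sumr.
  rewrite exchange_big /= cst big_mkcond; apply: ler_sum => l _.
  case: ifP => // lj; apply: deviation_norm => //; by rewrite eq_sym.
rewrite /cond_util mulr_sumr.
have : \sum_p pr p * (clogistic beta * avg_util us k - 3 * total_deviation p) <=
       \sum_p beta / 2 * (pr p * \sum_j copeland R hm tri n p j * avg_util us j).
  by apply: ler_sum => p _; rewrite [leRHS]mulrCA ler_wpM2l.
apply: le_trans.
under eq_bigr do rewrite mulrBr.
rewrite sumrB -mulr_suml pr_sum1 mul1r lerD2l lerN2.
under [leLHS]eq_bigr do rewrite mulrCA.
by rewrite -mulr_sumr -mulrA ler_pM2l.
Qed.

Lemma avg_util_ge0 j : 0 <= avg_util us j.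
Proof.
rewrite mulr_ge0 // sumr_ge0 // => i _; by case/andP: (us01 i j).
Qed.

Lemma cond_util_ge0 (f : voting_rule R m) : 0 <= cond_util beta f us.
Proof.
apply: sumr_ge0 => p _; rewrite mulr_ge0 ?pr_ge0 // sumr_ge0 // => j _.
by rewrite mulr_ge0 ?avg_util_ge0 ?win_prob_ge0.
Qed.

Lemma cond_util_le (f : voting_rule R m) :
  cond_util beta f us <= \sum_j avg_util us j.
Proof.
rewrite -[leRHS]mul1r -pr_sum1 mulr_suml; apply: ler_sum => p _.
apply: ler_wpM2l; first exact: pr_ge0.
apply: ler_sum => j _; apply: ler_piMl; first exact: avg_util_ge0.
rewrite -(win_prob_sum1 f p) (bigD1 j) //= lerDl.
by apply: sumr_ge0 => i _; exact: win_prob_ge0.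
Qed.

End Profile.
End ConditionalUtility.

(** * Integration over the utilities *)

Section AlmostSurelyBounded.
Context d (T : measurableType d) (R : realType) (P : probability T R).
Implicit Types f g : T -> R.

Lemma ae_bounded_Lfun1 f (M : R) : measurable_fun [set: T] f ->
  {ae P, forall x, `|f x| <= M} -> f \in Lfun P 1.
Proof.
move=> mf fM; apply/Lfun1_integrable/integrableP; split.
  exact/measurable_EFinP.
(* The sign of [M] is not assumed, while the comparison wants a nonnegative majorant. *)
have le : (\int[P]_x `|(EFin \o f) x| <= \int[P]_x (cst `|M|%:E) x)%E.
  apply: ae_ge0_le_integral => //.
  - by apply: measurableT_comp => //; exact/measurable_EFinP.
  - by move=> x _; rewrite lee_fin.
  - by apply: filterS fM => x fxM _ /=; rewrite lee_fin (le_trans fxM) ?ler_norm.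
apply: le_lt_trans le _.
by rewrite integral_cst // [X in (_ * X)%E](probability_setT P) mule1 ltry.
Qed.

(** Monotonicity asks for nonnegativity everywhere, so [f] and [g] are first replaced by their
    absolute values, which agree with them almost everywhere. *)
Lemma ae_le_expectation f g :
  measurable_fun [set: T] f -> measurable_fun [set: T] g ->
  {ae P, forall x, 0 <= f x <= g x} -> ('E_P[f] <= 'E_P[g])%E.
Proof.
move=> mf mg fg.
have norm (h : T -> R) : measurable_fun [set: T] h -> {ae P, forall x, 0 <= h x} ->
    ('E_P[h] = 'E_P[(fun x => `|h x|)%R])%E.
  move=> mh h0; rewrite unlock; apply: ae_eq_integral => //.
  - exact/measurable_EFinP.
  - by apply/measurable_EFinP; exact: measurableT_comp.
  - by apply: filterS h0 => x hx _; rewrite ger0_norm.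
rewrite (norm f) // ?(norm g) //; last 2 first.
- by apply: filterS fg => x /andP[/le_trans]; exact.
- by apply: filterS fg => x /andP[].
apply: expectation_le => //; try exact: measurableT_comp.
by apply: filterS fg => x /andP[f0 fgx]; rewrite !ger0_norm // (le_trans f0).
Qed.

Lemma ae_expectation_ge0 f : measurable_fun [set: T] f ->
  {ae P, forall x, 0 <= f x} -> (0 <= 'E_P[f])%E.
Proof.
move=> mf f0; have : ('E_P[cst 0%R] <= 'E_P[f])%E.
  by apply: ae_le_expectation => //; apply: filterS f0 => x f0; rewrite lexx.
by rewrite expectation_cst.
Qed.

End AlmostSurelyBounded.

Section IIDMarginal.
Context d (T : measurableType d) (R : realType) (V : probability T R).

(** Under [consT] the event is a rectangle: [A] times everything for the head, everything times a
    smaller such event for the tail. *)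
Lemma iid_law_marginal n (i : 'I_n) (A : set T) : measurable A ->
  iid_law V n ((@tnth n T)^~ i @^-1` A)%classic = V A.
Proof.
move=> mA; elim: n i => [[]//|n IH] i /=.
have mX : measurable ((@tnth n.+1 T)^~ i @^-1` A)%classic.
  by rewrite -[X in measurable X]setTI; exact: measurable_tnth.
rewrite /distribution /pushforward /=.
have [i0|[j ij]] : i = ord0 \/ exists j, i = lift ord0 j.
- by case: (unliftP ord0 i) => [j ->|->]; [right; exists j|left].
- rewrite i0 [X in (_ \x _)%E X](_ : _ = A `*` setT)%classic; last first.
    by apply/seteqP; split => -[x s] //= [].
  rewrite product_measure1E //.
  by rewrite [X in (_ * X)%E](probability_setT (iid_law V n)) mule1.
- rewrite ij [X in (_ \x _)%E X](_ : _ = setT `*`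
      ((@tnth n T)^~ j @^-1` A))%classic; last first.
    apply/seteqP; split => -[x s] /=; rewrite tnthS //; by case.
  rewrite product_measure1E //; last first.
    by rewrite -[X in measurable X]setTI; exact: measurable_tnth.
  by rewrite [X in (X * _)%E](probability_setT V) mul1e; exact: IH.
Qed.

Lemma expectation_iid_law n (i : 'I_n) (g : T -> R) :
  measurable_fun [set: T] g ->
  (fun us => g (tnth us i)) \in Lfun (iid_law V n) 1 ->
  ('E_(iid_law V n)[(fun us => g (tnth us i))%R] = 'E_V[g])%E.
Proof.
move=> mg /Lfun1_integrable gi; rewrite unlock.
have mt := measurable_tnth (T := T) i.
have := @integral_pushforward _ _ _ _ _ _ mt (iid_law V n) setT (EFin \o g).
rewrite preimage_setT /= => <- //; last exact/measurable_EFinP.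
by apply: eq_measure_integral => A mA _; exact: iid_law_marginal.
Qed.

End IIDMarginal.

Section Integration.
Variables (R : realType) (m : nat).

Lemma measurable_avg_util n (k : 'I_m) : measurable_fun
  [set: n.-tuple (m.-tuple R)] (fun us => avg_util us k).
Proof.
apply: measurable_funM => //; apply: measurable_sum => i.
by apply: (measurableT_comp (measurable_tnth k)); exact: measurable_tnth.
Qed.

Lemma measurable_plackett_luce (beta : R) r :
  measurable_fun [set: m.-tuple R] (fun u => plackett_luce beta u r).
Proof.
have me (k : 'I_m) :
    measurable_fun [set: m.-tuple R] (fun u => expR (beta * tnth u k)).
  apply: (measurableT_comp (@measurable_expR R)).
  by apply: measurable_funM => //; exact: measurable_tnth.
apply: measurable_prod => j _; apply: measurable_funM => //.
pose S (u : m.-tuple R) := \sum_(k <- [seq k <- index_enum 'I_m | (r j <= r k)%N])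
  expR (beta * tnth u k).
(* The inverse is read as the measurable power -1; the two agree because the sum is nonnegative. *)
rewrite [X in measurable_fun _ X](_ : _ = (@powR R ^~ (- 1)) \o S).
  by apply: (measurableT_comp (measurable_powR _)); exact: measurable_sum.
apply/funext => u; rewrite /= powR_inv1 /S ?big_filter //.
by apply: sumr_ge0 => k _; exact: expR_ge0.
Qed.

Lemma measurable_cond_util (beta : R) (f : voting_rule R m) n :
  measurable_fun [set: n.-tuple (m.-tuple R)] (cond_util beta f (n := n)).
Proof.
apply: measurable_sum => p; apply: measurable_funM.
  apply: measurable_prod => i _.
  apply: (measurableT_comp (measurable_plackett_luce beta _)).
  exact: measurable_tnth.
apply: measurable_sum => j; apply: measurable_funM => //.
exact: measurable_avg_util.
Qed.

Variable V : probability (m.-tuple R) R.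
Hypothesis V1 : V (@unit_utilities R m) = 1%E.

(** One coordinate at a time, so that [iid_law_marginal] carries each null set over to samples. *)
Let outside (j : 'I_m) : set (m.-tuple R) := [set u | ~ 0 <= tnth u j <= 1]%classic.

Let measurable_outside j : measurable (outside j).
Proof.
rewrite (_ : outside j = ~` ((@tnth m R)^~ j @^-1` `[0, 1]))%classic.
  apply: measurableC; rewrite -[X in measurable X]setTI.
  by apply: measurable_tnth => //; exact: measurable_itv.
by apply/seteqP; split => u; rewrite /outside /= in_itv.
Qed.

Let outside_null j : V (outside j) = 0.
Proof.
have mU : measurable (@unit_utilities R m).
  rewrite (_ : @unit_utilities R m = ~` (\bigcup_(j in setT) outside j))%classic.
    by apply: measurableC; apply: fin_bigcup_measurable.
  apply/seteqP; split => u /= => [uU [i _ ui]|uN i]; first exact: ui (uU i).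
  by apply: contrapT => ui; apply: uN; exists i.
apply/eqP; rewrite eq_le measure_ge0 andbT.
have <- : V (~` @unit_utilities R m)%classic = 0.
  by rewrite probability_setC // V1 subee.
apply: le_measure; rewrite ?inE //; first exact: measurableC.
by move=> u uj /(_ j).
Qed.

Lemma iid_law_unit_utilities n :
  {ae iid_law V n, forall us, forall i j, 0 <= tnth (tnth us i) j <= 1}.
Proof.
apply: filter_forall => i; apply: filter_forall => j.
exists ((@tnth n (m.-tuple R))^~ i @^-1` outside j)%classic; split => //.
- rewrite -[X in measurable X]setTI.
  by apply: measurable_tnth => //; exact: measurable_outside.
- by apply: etrans (outside_null j); apply: iid_law_marginal.
Qed.

Lemma Lfun_avg_util n k : (0 < n)%N ->
  (fun us : n.-tuple (m.-tuple R) => avg_util us k) \in Lfun (iid_law V n) 1.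
Proof.
move=> n0; apply: (@ae_bounded_Lfun1 _ _ _ _ _ 1); first exact: measurable_avg_util.
apply: filterS (iid_law_unit_utilities n) => us us01.
rewrite ger0_norm ?avg_util_ge0 // /avg_util ler_pdivrMl ?ltr0n // mulr1.
apply: (@le_trans _ _ (\sum_(i < n) 1)); last by rewrite sumr_const card_ord.
by apply: ler_sum => i _; case/andP: (us01 i k).
Qed.

Lemma Lfun_cond_util (beta : R) (f : voting_rule R m) n : 0 <= beta -> (0 < n)%N ->
  cond_util beta f (n := n) \in Lfun (iid_law V n) 1.
Proof.
move=> beta0 n0.
apply: (@ae_bounded_Lfun1 _ _ _ _ _ m%:R); first exact: measurable_cond_util.
apply: filterS (iid_law_unit_utilities n) => us us01.
rewrite ger0_norm ?cond_util_ge0 //.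
apply: (@le_trans _ _ (\sum_j avg_util us j)); first exact: cond_util_le.
apply: (@le_trans _ _ (\sum_(i < m) 1)); last by rewrite sumr_const card_ord.
apply: ler_sum => j _.
rewrite /avg_util ler_pdivrMl ?ltr0n // mulr1.
apply: (@le_trans _ _ (\sum_(i < n) 1)); last by rewrite sumr_const card_ord.
by apply: ler_sum => i _; case/andP: (us01 i j).
Qed.

Lemma util_cand_fin_num k : util_cand V k \is a fin_num.
Proof.
apply: expectation_fin_num; apply: (@ae_bounded_Lfun1 _ _ _ _ _ 1).
  exact: measurable_tnth.
exists (outside k); split => // u; rewrite /outside /= => uN u01; apply: uN.
by case/andP: u01 => u0 u1; rewrite ger0_norm.
Qed.

Lemma expectation_avg_util n k : (0 < n)%N ->
  ('E_(iid_law V n)[(fun us => avg_util us k)%R] = util_cand V k)%E.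
Proof.
move=> n0; pose X i (us : n.-tuple (m.-tuple R)) : R := tnth (tnth us i) k.
have XL i : X i \in Lfun (iid_law V n) 1.
  apply: (@ae_bounded_Lfun1 _ _ _ _ _ 1).
    by apply: (measurableT_comp (measurable_tnth k)); exact: measurable_tnth.
  apply: filterS (iid_law_unit_utilities n) => us us01.
  by case/andP: (us01 i k) => x0 x1; rewrite ger0_norm.
have aL := Lfun_avg_util k n0.
have : ('E_(iid_law V n)[(\sum_(Y <- [seq X i | i <- index_enum 'I_n]) Y)%R] =
    n%:R%:E * util_cand V k)%E.
  rewrite expectation_sum; last by move=> Y /mapP[i _ ->].
  rewrite big_map (eq_bigr (fun=> util_cand V k)).
    rewrite -(fineK (util_cand_fin_num k)) sumEFin.
    by rewrite sumr_const card_ord -EFinM mulr_natl.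
  move=> i _; exact: expectation_iid_law (measurable_tnth k) (XL i).
rewrite (_ : \sum_(Y <- _) Y = n%:R \o* (fun us => avg_util us k)); last first.
  apply/funext => us; rewrite big_map fct_sumE /= /avg_util mulrC mulVKf //.
  by rewrite pnatr_eq0 -lt0n.
rewrite expectationZl //.
have := expectation_fin_num aL; have := util_cand_fin_num k.
move: (util_cand V k) ('E_ _[_])%E => x y /fineK <- /fineK <-.
rewrite -!EFinM => -[/mulfI -> //]; by rewrite pnatr_eq0 -lt0n.
Qed.

Lemma util_cand_ge0 k : (0 <= util_cand V k)%E.
Proof.
(* A sample of one voter suffices to reuse the almost sure bounds on utilities. *)
rewrite -(@expectation_avg_util 1) //.
apply: ae_expectation_ge0; first exact: measurable_avg_util.
by apply: filterS (iid_law_unit_utilities 1) => us us01; exact: avg_util_ge0.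
Qed.

Section UtilRule.
Variables (beta : R) (n : nat).
Hypotheses (beta0 : 0 <= beta) (n0 : (0 < n)%N).

Lemma util_rule_fin_num f : util_rule beta V f n \is a fin_num.
Proof. exact/expectation_fin_num/Lfun_cond_util. Qed.

Lemma util_rule_ge0 f : (0 <= util_rule beta V f n)%E.
Proof.
apply: ae_expectation_ge0; first exact: measurable_cond_util.
by apply: filterS (iid_law_unit_utilities n) => us us01; exact: cond_util_ge0.
Qed.

(** Serves the degenerate case: if all expected utilities vanish, so does that of the rule. *)
Lemma util_rule_le f :
  (util_rule beta V f n <= \sum_j util_cand V j)%E.
Proof.
pose A j (us : n.-tuple (m.-tuple R)) : R := avg_util us j.
have : ('E_(iid_law V n)[(\sum_(Y <- [seq A j | j <- index_enum 'I_m]) Y)%R] =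
    \sum_j util_cand V j)%E.
  rewrite expectation_sum; last by move=> Y /mapP[j _ ->]; exact: Lfun_avg_util.
  by rewrite big_map; apply: eq_bigr => j _; exact: expectation_avg_util.
rewrite (_ : \sum_(Y <- _) Y = fun us => \sum_j A j us); last first.
  by apply/funext => us; rewrite big_map fct_sumE.
move=> <-; apply: ae_le_expectation.
- exact: measurable_cond_util.
- by apply: measurable_sum => j; exact: measurable_avg_util.
- apply: filterS (iid_law_unit_utilities n) => us us01.
  by rewrite cond_util_ge0 //= cond_util_le.
Qed.

(** The error sits on the right so that the left integrand is nonnegative, as [ae_le_expectation]
    requires. *)
Lemma util_rule_copeland (hm : (1 < m)%N) (tri : rel 'I_m) (d : R) k :
  strict_total_order tri -> 0 < d ->
  ((clogistic beta)%:E * util_cand V k <=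
   (beta / 2)%:E * util_rule beta V (copeland R hm tri) n +
   (3 * m%:R ^+ 2 * (d / 2 + (2 * d * n%:R)^-1))%:E)%E.
Proof.
move=> htri d0; set K := 3 * _ * _.
have cL := Lfun_cond_util (copeland R hm tri) beta0 n0.
rewrite -(expectation_avg_util k n0) -expectationZl; last exact: Lfun_avg_util.
rewrite -expectationZl // -(expectation_cst (iid_law V n)).
rewrite -expectationD; last 2 first.
- exact: Lfun_scale.
- exact: Lfun_cst.
apply: ae_le_expectation.
- by apply: measurable_funM => //; exact: measurable_avg_util.
- apply: measurable_funD => //.
  by apply: measurable_funM => //; exact: measurable_cond_util.
- apply: filterS (iid_law_unit_utilities n) => us us01 /=.
  rewrite mulr_ge0 ?avg_util_ge0 ?clogistic_ge0 //=.
  have := cond_util_copeland hm htri beta0 n0 us01 k d0; rewrite -/K.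
  rewrite (mulrC (clogistic beta)) (mulrC (beta / 2)); lra.
Qed.

End UtilRule.
End Integration.

(** * The limit superior *)

(** The limit superior is an infimum of suprema over neighborhoods of infinity; the set where the
    bound holds is such a neighborhood. *)
Lemma limn_esup_le (R : realType) (u : nat -> \bar R) (c : R) :
  (forall e, 0 < e -> \forall n \near \oo%classic, (u n <= (c + e)%:E)%E) ->
  (limn_esup u <= c%:E)%E.
Proof.
move=> uc; apply/lee_addgt0Pr => e e0; apply: ge_ereal_inf.
exists (ereal_sup (u @` [set n | (u n <= (c + e)%:E)%E])%classic).
  by exists [set n | (u n <= (c + e)%:E)%E]%classic => //; exact: uc.
by apply: ge_ereal_sup => _ [n un <-]; rewrite -EFinD.
Qed.

Section Ratio.
Variables (R : realType) (m : nat) (hm : (1 < m)%N) (tri : rel 'I_m).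
Hypothesis htri : strict_total_order tri.
Variables (beta : R) (V : probability (m.-tuple R) R).
Hypotheses (beta1 : 1 <= beta) (V1 : V (@unit_utilities R m) = 1%E).

Let bound : R := beta * ((1 + expR (- beta)) / (1 - expR (- beta))).

Let beta0 : 0 < beta. Proof. exact: lt_le_trans beta1. Qed.

Let e0 : 0 < expR (- beta). Proof. exact: expR_gt0. Qed.

Let e1 : expR (- beta) < 1. Proof. by rewrite expR_lt1 oppr_lt0. Qed.

Let boundE : bound * clogistic beta = beta / 2.
Proof.
rewrite /bound /clogistic; move: (expR _) e0 e1 => e ? ?; field.
by rewrite !gt_eqF //; lra.
Qed.

(** Covers the ratio 0/0, which is 1 by convention. *)
Let bound_ge1 : 1 <= bound.
Proof.
by rewrite /bound; apply: mulr_ege1 => //; rewrite ler_pdivlMr; move: e0 e1; lra.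
Qed.

Let clogistic_gt0 : 0 < clogistic beta.
Proof.
rewrite -(pmulr_rgt0 _ (lt_le_trans ltr01 bound_ge1)) boundE.
by rewrite divr_gt0.
Qed.

Lemma max_utilP : exists k, [/\ max_util V = util_cand V k &
  forall j, (util_cand V j <= util_cand V k)%E].
Proof.
have [k _ kE] := @eq_bigmax _ _ _ (-oo)%E (Ordinal (ltnW hm)) xpredT
  (util_cand V) isT (fun _ _ => leNye _).
exists k; split => // j; rewrite -kE; exact: le_bigmax.
Qed.

Lemma util_rule_copeland_near k (eta : R) : 0 < eta ->
  \forall n \near \oo%classic,
   ((clogistic beta * fine (util_cand V k) - eta)%:E <=
    (beta / 2)%:E * util_rule beta V (copeland R hm tri) n)%E.
Proof.
move=> eta0; pose K : R := 3 * m%:R ^+ 2.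
have K0 : 0 < K by rewrite mulr_gt0 // exprn_gt0 // ltr0n ltnW.
(* With [d = eta / K] the first error term is [eta / 2], and the second is at most [eta / 2] once
   [n >= K ^+ 2 / eta ^+ 2]. *)
have d0 : 0 < eta / K by rewrite divr_gt0.
have [N _ hN] := nbhs_infty_ger (R := R) (K ^+ 2 / eta ^+ 2).
exists N.+1 => // n /= Nn; have n0 : (0 < n)%N by apply: leq_ltn_trans Nn.
have := util_rule_copeland V1 (ltW beta0) n0 hm k htri d0.
have := hN n (ltnW Nn); rewrite /= -/K.
rewrite -(fineK (util_cand_fin_num V1 k)).
rewrite -(fineK (util_rule_fin_num V1 (ltW beta0) n0 (copeland R hm tri))).
rewrite -!EFinM -EFinD !lee_fin /=.
move: (fine _) (fine _) => x y.
rewrite ler_pdivrMr ?exprn_gt0 // => Kn h.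
suff : K * (eta / K / 2 + (2 * (eta / K) * n%:R)^-1) <= eta by lra.
have nR0 : 0 < (n%:R : R) by rewrite ltr0n.
rewrite mulrDr.
have -> : K * (eta / K / 2) = eta / 2 by field; rewrite gt_eqF.
have -> : K * (2 * (eta / K) * n%:R)^-1 = K ^+ 2 / (2 * eta * n%:R).
  by field; rewrite !gt_eqF.
suff : K ^+ 2 / (2 * eta * n%:R) <= eta / 2 by lra.
rewrite ler_pdivrMr; last by rewrite !mulr_gt0.
nra.
Qed.

Lemma limn_esup_copeland : (limn_esup (fun n =>
  util_ratio (max_util V) (util_rule beta V (copeland R hm tri) n)) <= bound%:E)%E.
Proof.
have [k [-> kmax]] := max_utilP.
have := util_cand_ge0 V1 k; rewrite le_eqVlt => /predU1P[k0|k0].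
  (* Degenerate case: the maximal utility is 0, hence so is the utility of the rule for every
     [n >= 1]. *)
  apply: limn_esup_le => e e0'; exists 1%N => // n n0.
  have U0 : util_rule beta V (copeland R hm tri) n = 0%E.
    apply/eqP; rewrite eq_le; apply/andP; split; last first.
      exact: util_rule_ge0.
    apply: (le_trans (util_rule_le V1 beta n0 _)).
    rewrite big1 // => j _; apply/eqP; rewrite eq_le; apply/andP; split.
      by rewrite k0 kmax.
    exact: util_cand_ge0.
  rewrite -k0 U0 /util_ratio eqxx /= lee_fin.
  by move: bound_ge1; lra.
apply: limn_esup_le => e e0'.
have kfin := util_cand_fin_num V1 k.
pose M := fine (util_cand V k).
have ME : util_cand V k = M%:E by rewrite /M fineK.
have M0 : 0 < M by rewrite -lte_fin -ME.
have be0 : 0 < bound + e by move: bound_ge1; lra.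
(* This slack leaves [clogistic beta * M * bound / (bound + e)] on the left, which by [boundE] is
   exactly what yields [M <= (bound + e) * U]. *)
have eta0 : 0 < clogistic beta * M * (e / (bound + e)).
  by rewrite !mulr_gt0 ?invr_gt0.
have [N _ hN] := util_rule_copeland_near k eta0.
exists N.+1 => // n /= Nn; have n0 : (0 < n)%N by apply: leq_ltn_trans Nn.
have := hN n (ltnW Nn); rewrite /= -/M.
rewrite ME -(fineK (util_rule_fin_num V1 (ltW beta0) n0 (copeland R hm tri))).
set U := fine _; rewrite -EFinM lee_fin => le.
have UM : M <= (bound + e) * U.
  have bc0 : 0 < bound * clogistic beta by rewrite boundE divr_gt0.
  rewrite -(ler_pM2l bc0) [leRHS]mulrCA boundE -ler_pdivrMl //.
  apply: le_trans le; rewrite le_eqVlt -boundE; apply/orP; left; apply/eqP.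
  by field; rewrite gt_eqF.
(* Positivity of [U] keeps the ratio away from the value [+oo] of a division by 0. *)
have U0 : 0 < U by rewrite -(pmulr_rgt0 _ be0); exact: lt_le_trans UM.
rewrite /util_ratio !eqe (gt_eqF M0) /= inver (gt_eqF U0) -EFinM lee_fin.
by rewrite ler_pdivrMr.
Qed.
End Ratio.

Theorem theorem6p3 (R : realType) (m : nat) (hm : (1 < m)%N)
    (tri : rel 'I_m) (htri : strict_total_order tri)
    (beta : R) (hbeta : 1 <= beta) :
  (distortion beta (copeland R hm tri) <=
     (beta * ((1 + expR (- beta)) / (1 - expR (- beta))))%:E)%E.
Proof.
by apply: ge_ereal_sup => _ [V V1 <-]; exact: limn_esup_copeland.
Qed.
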